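(* Let $d\ge2$, let $\{v_n\}_{n\ge1}$ be a $\frac12$-uniformly distributed sequence of points in $\mathbb{T}^d$, and fix $0<t<\frac12$. Then for every $\epsilon>0$ there is a constant $C_\epsilon>0$ such that for all integers $N\ge1$, $$\#\{(n,m)\in\{1,\dots,N\}^2:\|v_n-v_m\|=t\}\le C_\epsilon N^{2-\frac{2}{d+1}+\epsilon}.$$
   Context: $\mathbb{T}^d=\mathbb{R}^d/\mathbb{Z}^d$, identified with the unit cube $[0,1]^d$ (opposite faces glued). For $x\in\mathbb{R}^d$, $\|x\|=\min_{m\in\mathbb{Z}^d}|x-m|$ is the Euclidean distance to the integer lattice; it is well defined on $\mathbb{T}^d$. For $\gamma\in(0,\frac12]$, a sequence of points $\{v_n\}_{n\ge1}$ in $[0,1]^d$ (or $\mathbb{T}^d$) is $\gamma$-uniformly distributed if for every $\epsilon>0$ there is a constant $C_\epsilon$ such that for every $k\in\mathbb{Z}^d\setminus\{0\}$ and every integer $N\ge 1$, $$\left|\frac1N\sum_{n=1}^N e^{2\pi i k\cdot v_n}\right|\le C_\epsilon|k|^\epsilon N^{-\gamma}.$$ The constant $C_\epsilon$ in the claim may depend on $d$, $t$ and the sequence, but not on $N$. *)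

(* Defs.v *)
From HB Require Import structures.
From mathcomp Require Import all_boot all_order all_algebra.
From mathcomp Require Import all_classical all_reals all_analysis.
From mathcomp Require Import complex lra.

Set Implicit Arguments.
Unset Strict Implicit.
Unset Printing Implicit Defensive.

Import Order.TTheory GRing.Theory Num.Theory.

Local Open Scope classical_set_scope.
Local Open Scope ring_scope.
Local Open Scope complex_scope.

(* The canonical norm on 'rV[R]_d in MathComp-Analysis is the sup norm, hence
   a separate Euclidean norm. *)
Definition enorm (R : realType) (d : nat) (x : 'rV[R]_d) : R :=
  Num.sqrt (\sum_(i < d) x 0 i ^+ 2).

Definition dotp (R : realType) (d : nat) (x y : 'rV[R]_d) : R :=
  \sum_(i < d) x 0 i * y 0 i.

Definition lattice_pt (R : realType) (d : nat) (m : 'rV[int]_d) : 'rV[R]_d :=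
  map_mx (fun z : int => z%:~R) m.

(* The infimum is a minimum, see [lattice_dist_min]. *)
Definition lattice_dist (R : realType) (d : nat) (x : 'rV[R]_d) : R :=
  inf [set enorm (x - lattice_pt R m) | m in [set: 'rV[int]_d]].

(* A point of the torus R^d / Z^d is given by a representative in [0, 1]^d.
   Opposite faces need no explicit gluing: [lattice_dist] and [expi2pi] of an
   integer frequency are Z^d-periodic. *)
Definition unit_cube (R : realType) (d : nat) : set 'rV[R]_d :=
  [set x | forall i, 0 <= x 0 i <= 1].

(* e^(2 pi i theta) *)
Definition expi2pi (R : realType) (theta : R) : R[i] :=
  cos (2 * pi * theta) +i* sin (2 * pi * theta).

(* Sequences are indexed from 1; the value [v 0] is never used.  The inequality
   is between elements of R[i], where [`|z|] is the (real) modulus of z. *)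
Definition uniformly_distributed (R : realType) (d : nat) (gamma : R)
    (v : nat -> 'rV[R]_d) : Prop :=
  forall eps : R, 0 < eps ->
  exists C : R, forall (k : 'rV[int]_d) (N : nat), k != 0 -> (1 <= N)%N ->
    `| N%:R^-1 * \sum_(1 <= n < N.+1) expi2pi (dotp (lattice_pt R k) (v n)) |
    <= (C * enorm (lattice_pt R k) `^ eps * N%:R `^ (- gamma))%:C.

(* The index i : 'I_N stands for i.+1 in {1, ..., N}. *)
Definition dist_pairs (R : realType) (d : nat) (v : nat -> 'rV[R]_d) (t : R)
    (N : nat) : {set 'I_N * 'I_N} :=
  [set p : 'I_N * 'I_N | lattice_dist (v p.1.+1 - v p.2.+1) == t]%SET.

Lemma near_int (R : realType) (x : R) :
  exists z : int, forall w : int, (x - z%:~R) ^+ 2 <= (x - w%:~R) ^+ 2.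
Proof.
exists (Num.floor (x + 2^-1)) => w.
set z := Num.floor _.
have [h1 h2] : z%:~R <= x + 2^-1 /\ x + 2^-1 < z%:~R + 1.
  by rewrite floor_le -[1]/(1%:~R) -intrD floorD1_gt.
have h : (2 : R)^-1 + 2^-1 = 1 by rewrite -mulr2n -[_ *+ 2]mulr_natr mulVf ?pnatr_eq0.
rewrite -subr_ge0 subr_sqr.
case: (ltgtP w z) => [wz|zw|->]; last by rewrite subrr mul0r.
- have : w%:~R + 1 <= z%:~R :> R by rewrite -[1]/(1%:~R) -intrD ler_int lezD1.
  by move=> hw; apply: mulr_ge0; lra.
- have : z%:~R + 1 <= w%:~R :> R by rewrite -[1]/(1%:~R) -intrD ler_int lezD1.
  by move=> hw; apply: mulr_le0; lra.
Qed.

Lemma lattice_dist_min (R : realType) (d : nat) (x : 'rV[R]_d) :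
  exists2 m : 'rV[int]_d, lattice_dist x = enorm (x - lattice_pt R m) &
    forall m' : 'rV[int]_d, lattice_dist x <= enorm (x - lattice_pt R m').
Proof.
have /choice [f fP] := fun i : 'I_d => near_int (x 0 i).
pose m : 'rV[int]_d := \row_i f i.
have mP m' : enorm (x - lattice_pt R m) <= enorm (x - lattice_pt R m').
  apply: ler_wsqrtr; apply: ler_sum => i _.
  by rewrite !mxE; exact: fP.
suff E : lattice_dist x = enorm (x - lattice_pt R m).
  by exists m => // m'; rewrite E.
apply/eqP; rewrite eq_le; apply/andP; split.
- apply: ge_inf; last by exists m.
  by exists (enorm (x - lattice_pt R m)) => _ [m' _ <-].
- apply: lb_le_inf; first by exists (enorm (x - lattice_pt R m)); exists m.
  by move=> _ [m' _ <-].
Qed.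

(* Main.v *)
Require Import Defs.
From mathcomp Require Import all_boot all_order all_algebra.
From mathcomp Require Import all_classical all_reals all_analysis.
From mathcomp Require Import complex ring lra zify.
Import Order.TTheory GRing.Theory Num.Theory.
Local Open Scope ring_scope.

Set Implicit Arguments.
Unset Strict Implicit.
Unset Printing Implicit Defensive.

(** A pair at distance t has its difference v_n - v_m on the sphere of radius t,
    so it suffices to bound the sum over n, m of a function on the torus that is
    bounded below on that sphere.  Choose an integer M, let D be the sum of the
    characters e(j.x) over frequencies j in [0, M)^d, and cut the unit cube into
    L^d small cells, L = 8 d M.  On a cell based at 0 the phases are so small
    that |D| >= M^d / 2; hence the sum of |D(x - y_g)|^2 over the cells g that
    meet the sphere, y_g being the corner of g, is at least M^(2d) / 4 on the
    sphere.  Only about M^(d-1) cells meet it ([card_sphere_cells]): a point of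
    the sphere has a coordinate of size at least t / d, and that coordinate is a
    Lipschitz function of the others.

    Expanding the square ([sum_square_trig_poly]) turns the sum over n, m into a
    sum over pairs of frequencies j, l of
      |sum_n e((j - l).v_n)|^2 times the exponential sum of j - l over cells.
    The diagonal j = l contributes M^d N^2 M^(d-1).  Off the diagonal the first
    factor is at most N M^eps by uniform distribution, and the second factor is
    needed only on average over l.  Its mean square is controlled by
    Parseval's identity on the finite group (Z/L)^d ([discrete_parseval]), so its
    mean is O(M^((d-1)/2)): the average information replaces the stationary
    phase bound |k|^(-(d-1)/2) for the Fourier transform of the sphere.  After
    division by M^(2d) / 4, the number of pairs is
      O(N^2 / M + N M^((d-1)/2 + eps))      ([dist_pairs_bound]),
    and M of size N^(2/(d+1)) balances the two terms. *)

(** * The additive character of the circle *)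

Lemma expi2piD (R : realType) (x y : R) :
  expi2pi (x + y) = expi2pi x * expi2pi y.
Proof.
rewrite /expi2pi mulrDr cosD sinD.
by apply/eqP; rewrite eq_complex /= eqxx /= addrC.
Qed.

Lemma expi2pi0 (R : realType) : expi2pi (0 : R) = 1.
Proof. by rewrite /expi2pi mulr0 cos0 sin0. Qed.

Lemma norm_expi2pi (R : realType) (x : R) : `|expi2pi x| = 1.
Proof. by rewrite normc_def /= cos2Dsin2 sqrtr1. Qed.

Lemma expi2piN (R : realType) (x : R) : expi2pi (- x) = (expi2pi x)^*.
Proof.
have e1 : expi2pi (- x) * expi2pi x = 1 by rewrite -expi2piD addNr expi2pi0.
have u : expi2pi x != 0 by rewrite -normr_eq0 norm_expi2pi oner_eq0.
apply: (mulIf u); rewrite e1 mulrC -normCK norm_expi2pi expr1n //.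
Qed.

Lemma expi2piMn (R : realType) (x : R) (n : nat) :
  expi2pi (n%:R * x) = expi2pi x ^+ n.
Proof.
elim: n => [|n IHn]; first by rewrite mul0r expi2pi0 expr0.
by rewrite exprS -IHn -expi2piD -natr1 mulrDl mul1r addrC.
Qed.

Lemma expi2pi_int (R : realType) (z : int) : expi2pi (z%:~R : R) = 1.
Proof.
have e1 : expi2pi (1 : R) = 1.
  by rewrite /expi2pi mulr1 mulr_natl cos2pi sin2pi.
have en (n : nat) : expi2pi (n%:R : R) = 1.
  by rewrite -[n%:R]mulr1 expi2piMn e1 expr1n.
case: z => n; first exact: en.
by rewrite NegzE mulrNz expi2piN -pmulrn en conjC1.
Qed.

(** cos (2 pi x) = 1 - 2 sin^2 (pi x), and the sine vanishes only at integers. *)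
Lemma expi2pi_neq1 (R : realType) (x : R) : x != 0 -> `|x| < 1 ->
  expi2pi x != 1.
Proof.
move=> x0 x1; apply/eqP => -[c1 _].
have s0 y : 0 < y < 1 -> sin (pi * y) != 0 :> R.
  move=> /andP[y0 y1]; rewrite gt_eqF// sin_gt0_pi// mulr_gt0 ?pi_gt0//=.
  by rewrite gtr_pMr ?pi_gt0.
have : sin (pi * `|x|) != 0 by rewrite s0 // normr_gt0 x0.
have -> : sin (pi * `|x|) = 0; last by rewrite eqxx.
have c2 : cos ((pi * `|x|) *+ 2) = 1.
  rewrite -[RHS]c1 -[in RHS]cos_norm !normrM (ger0_norm (@pi_ge0 R)) normr_nat.
  by rewrite -mulr_natl mulrA.
move: c2; rewrite cos_mulr2n cos2sin2 => h.
apply/eqP; rewrite -sqrf_eq0; apply/eqP; move: h; lra.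
Qed.

(** Doubling the angle keeps it within pi/2, so cos (2 a) >= 0, which forces
    cos a ^2 >= 1/2. *)
Lemma cos_ge_half (R : realType) (x : R) : `|x| <= 1 / 8 ->
  1 / 2 <= cos (2 * pi * x).
Proof.
rewrite ler_norml => /andP[x1 x2]; have p0 := @pi_ge0 R.
have h1 : 0 <= pi * (1 / 8 - x) by apply: mulr_ge0 => //; lra.
have h2 : 0 <= pi * (1 / 8 + x) by apply: mulr_ge0 => //; lra.
have c0 : 0 <= cos (2 * pi * x).
  by apply: cos_ge0_pihalf; apply/andP; split; lra.
have : 0 <= cos ((2 * pi * x) *+ 2).
  by apply: cos_ge0_pihalf; apply/andP; split; lra.
rewrite cos_mulr2n => h; nra.
Qed.

(** A geometric sum whose ratio is an L-th root of unity, trivial only for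
    p = q. *)
Lemma sum_roots_unity (R : realType) (L : nat) (p q : 'I_L) :
  \sum_(a < L) expi2pi (a%:R * (p%:R / L%:R - q%:R / L%:R) : R) =
    (L * (p == q))%:R.
Proof.
have [<-|pq] := eqVneq p q.
  rewrite subrr (eq_bigr (fun=> 1)); last by move=> i _; rewrite mulr0 expi2pi0.
  by rewrite sumr_const card_ord muln1.
have L0 : 0 < L%:R :> R by rewrite ltr0n (leq_ltn_trans _ (ltn_ord p)).
set x := _ - _ : R; rewrite muln0.
under eq_bigr do rewrite expi2piMn.
have z1 : expi2pi x - 1 != 0.
  rewrite subr_eq0; apply: expi2pi_neq1.
    rewrite subr_eq0; apply: contra pq => /eqP /(mulIf (invr_neq0 (lt0r_neq0 L0))).
    by move/eqP; rewrite eqr_nat.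
  have [p1 q1] : (p%:R < L%:R :> R) /\ (q%:R < L%:R :> R) by rewrite !ltr_nat.
  rewrite /x -mulrBl normrM normfV (gtr0_norm L0) ltr_pdivrMr// mul1r ltr_norml.
  have := ler0n R p; have := ler0n R q; lra.
apply: (mulfI z1); rewrite -subrX1 mulr0 -expi2piMn /x mulrBr !mulrA.
rewrite ![L%:R * _]mulrC !mulfK ?gt_eqF// expi2piD expi2piN.
by rewrite ![_%:R : R]pmulrn !expi2pi_int conjC1 mulr1 subrr.
Qed.

(** * Characters of the torus and finite Fourier analysis *)

Definition chi (R : realType) (d : nat) (k : 'rV[int]_d) (x : 'rV[R]_d) : R[i] :=
  expi2pi (dotp (lattice_pt R k) x).

Lemma chiD (R : realType) (d : nat) (k : 'rV[int]_d) (x y : 'rV[R]_d) :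
  chi k (x + y) = chi k x * chi k y.
Proof.
rewrite /chi -expi2piD /dotp -big_split; congr expi2pi; apply: eq_bigr => i _.
by rewrite !mxE mulrDr.
Qed.

Lemma chiDl (R : realType) (d : nat) (k l : 'rV[int]_d) (x : 'rV[R]_d) :
  chi (k + l) x = chi k x * chi l x.
Proof.
rewrite /chi -expi2piD /dotp -big_split; congr expi2pi; apply: eq_bigr => i _.
by rewrite !mxE intrD mulrDl.
Qed.

Lemma chiN (R : realType) (d : nat) (k : 'rV[int]_d) (x : 'rV[R]_d) :
  chi k (- x) = (chi k x)^*.
Proof.
rewrite /chi -expi2piN /dotp -sumrN; congr expi2pi; apply: eq_bigr => i _.
by rewrite !mxE mulrN.
Qed.

Lemma chiNl (R : realType) (d : nat) (k : 'rV[int]_d) (x : 'rV[R]_d) :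
  chi (- k) x = (chi k x)^*.
Proof.
rewrite /chi -expi2piN /dotp -sumrN; congr expi2pi; apply: eq_bigr => i _.
by rewrite !mxE intrN mulNr.
Qed.

Lemma norm_chi (R : realType) (d : nat) (k : 'rV[int]_d) (x : 'rV[R]_d) :
  `|chi k x| = 1.
Proof. exact: norm_expi2pi. Qed.

Lemma chi0 (R : realType) (d : nat) (x : 'rV[R]_d) : chi 0 x = 1.
Proof.
rewrite /chi /dotp big1 ?expi2pi0// => i _.
by rewrite !mxE mul0r.
Qed.

Lemma chi_lattice (R : realType) (d : nat) (k m : 'rV[int]_d) :
  chi k (lattice_pt R m) = 1.
Proof.
rewrite /chi -[RHS](expi2pi_int R (\sum_(i < d) k 0 i * m 0 i)).
congr expi2pi; rewrite (rmorph_sum intr); apply: eq_bigr => i _.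
by rewrite !mxE -intrM.
Qed.

Definition freq (d L : nat) (j : {ffun 'I_d -> 'I_L}) : 'rV[int]_d :=
  \row_i (j i : nat)%:Z.

Definition grid (R : realType) (d L : nat) (g : {ffun 'I_d -> 'I_L}) :
  'rV[R]_d := \row_i ((g i)%:R / L%:R).
Arguments grid : clear implicits.
Arguments grid R {d L} g.

(** Orthogonality in (Z/L)^d: the sum factors over the coordinates. *)
Lemma sum_chi_grid (R : realType) (d L : nat) (g h : {ffun 'I_d -> 'I_L}) :
  \sum_(l : {ffun 'I_d -> 'I_L}) chi (freq l) (grid R g - grid R h) =
    (L ^ d * (g == h))%:R.
Proof.
have E (l : {ffun 'I_d -> 'I_L}) : chi (freq l) (grid R g - grid R h) =
    \prod_(i < d) expi2pi ((l i)%:R * ((g i)%:R / L%:R - (h i)%:R / L%:R) : R).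
  rewrite /chi /dotp.
  rewrite (big_morph (@expi2pi R) (@expi2piD R) (@expi2pi0 R)).
  by apply: eq_bigr => i _; rewrite !mxE.
under eq_bigr do rewrite E.
rewrite -(bigA_distr_bigA (fun i (a : 'I_L) =>
  expi2pi (a%:R * ((g i)%:R / L%:R - (h i)%:R / L%:R) : R))) /=.
under eq_bigr do rewrite sum_roots_unity.
rewrite -natr_prod; congr _%:R.
have [->|gh] := eqVneq g h.
  under eq_bigr do rewrite eqxx muln1.
  by rewrite prod_nat_const card_ord muln1.
have /existsP[i ghi] : [exists i, g i != h i].
  rewrite -negb_forall; apply: contra gh => /forallP gh.
  by apply/eqP/ffunP => i; apply/eqP.
by rewrite (bigD1 i)//= (negPf ghi) !muln0 mul0n.
Qed.

Lemma discrete_parseval (R : realType) (d L : nat)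
    (c : {ffun 'I_d -> 'I_L} -> R[i]) :
  \sum_(l : {ffun 'I_d -> 'I_L}) `|\sum_g c g * chi (freq l) (grid R g)| ^+ 2 =
    (L ^ d)%:R * \sum_g `|c g| ^+ 2.
Proof.
have E (l : {ffun 'I_d -> 'I_L}) :
    `|\sum_g c g * chi (freq l) (grid R g)| ^+ 2 =
    \sum_g \sum_h c g * (c h)^* * chi (freq l) (grid R g - grid R h).
  rewrite normCK rmorph_sum big_distrlr /=.
  apply: eq_bigr => g _; apply: eq_bigr => h _.
  by rewrite chiD chiN rmorphM mulrACA.
under eq_bigr do rewrite E.
rewrite exchange_big mulr_sumr; apply: eq_bigr => g _.
rewrite exchange_big (bigD1 g)//= [X in _ + X]big1 ?addr0 => [|h hg].
  by rewrite /= -mulr_sumr sum_chi_grid eqxx muln1 normCK mulrC.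
by rewrite -mulr_sumr sum_chi_grid eq_sym (negPf hg) muln0 mulr0.
Qed.

(** |D|^2 is a combination of characters e((f j - f l).x), each of which splits
    at x_n - x_m - y_g as a product of functions of n, of m and of g; the
    sums over n and m are conjugate to each other. *)
Lemma sum_square_trig_poly (R : realType) (d : nat) (I G J : finType)
    (x : I -> 'rV[R]_d) (y : G -> 'rV[R]_d) (f : J -> 'rV[int]_d)
    (A : {set G}) :
  \sum_n \sum_m \sum_(g in A) `|\sum_j chi (f j) (x n - x m - y g)| ^+ 2 =
  \sum_j \sum_l `|\sum_n chi (f j - f l) (x n)| ^+ 2 *
    \sum_(g in A) chi (f j - f l) (- y g).
Proof.
have E n m g : `|\sum_j chi (f j) (x n - x m - y g)| ^+ 2 =
    \sum_j \sum_l chi (f j - f l) (x n) *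
      (chi (f j - f l) (x m))^* * chi (f j - f l) (- y g).
  rewrite normCK rmorph_sum big_distrlr /=.
  apply: eq_bigr => j _; apply: eq_bigr => l _.
  by rewrite -chiNl -chiDl !chiD [chi _ (- x m)]chiN.
transitivity (\sum_n \sum_m \sum_j \sum_l
    chi (f j - f l) (x n) * (chi (f j - f l) (x m))^* *
    \sum_(g in A) chi (f j - f l) (- y g)).
  apply: eq_bigr => n _; apply: eq_bigr => m _.
  under eq_bigr do rewrite E.
  rewrite exchange_big; apply: eq_bigr => j _.
  rewrite exchange_big; apply: eq_bigr => l _.
  by rewrite mulr_sumr.
under eq_bigr do rewrite exchange_big.
rewrite exchange_big; apply: eq_bigr => j _.
under eq_bigr do rewrite exchange_big.
rewrite exchange_big; apply: eq_bigr => l _.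
rewrite normCK rmorph_sum big_distrlr /= mulr_suml.
by apply: eq_bigr => n _; rewrite mulr_suml.
Qed.

(** * Grid cells that meet a sphere *)

Definition cell (R : realType) (d L : nat) (g : {ffun 'I_d -> 'I_L}) :
    set 'rV[R]_d :=
  [set x | forall i, (g i)%:R <= L%:R * x 0 i < (g i).+1%:R].
Arguments cell : clear implicits.
Arguments cell R {d L} g.

(** From u_i^2 - u'_i^2 = sum over j <> i of (u'_j^2 - u_j^2), the left side
    factors as (u_i - u'_i) (u_i + u'_i).  As the coordinates have the same sign
    and size at least t / d, the second factor is at least 2 t / d, while each
    term on the right is at most 2 t e. *)
Lemma sphere_coord_close (R : realType) (d : nat) (t e : R)
    (u u' : 'I_d -> R) (i : 'I_d) :
  0 < t -> 0 <= e -> \sum_j u j ^+ 2 = t ^+ 2 -> \sum_j u' j ^+ 2 = t ^+ 2 ->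
  (forall j, j != i -> `|u j - u' j| <= e) ->
  t <= d%:R * `|u i| -> t <= d%:R * `|u' i| -> (0 <= u i) = (0 <= u' i) ->
  `|u i - u' i| <= d%:R ^+ 2 * e.
Proof.
move=> t0 e0 ut u't ue ui u'i sgn.
have coord_le (w : 'I_d -> R) j : \sum_j w j ^+ 2 = t ^+ 2 -> `|w j| <= t.
  move=> wt; rewrite -(@ler_pXn2r _ 2)// ?nnegrE ?(ltW t0)// -wt.
  rewrite (bigD1 j)//= real_normK ?num_real// lerDl.
  by apply: sumr_ge0 => l _; exact: sqr_ge0.
have d0 : 0 < d%:R :> R by rewrite ltr0n (leq_ltn_trans _ (ltn_ord i)).
have prodE : (u i - u' i) * (u i + u' i) =
    \sum_(j | j != i) (u' j - u j) * (u' j + u j).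
  have := ut; rewrite -u't (bigD1 i)//= [RHS](bigD1 i)//= => h.
  rewrite -subr_sqr; apply/eqP; rewrite subr_eq addrC -subr_eq; apply/eqP.
  under eq_bigr do rewrite -subr_sqr.
  by rewrite sumrB; lra.
have sum_le : `|u i - u' i| * `|u i + u' i| <= d%:R * (e * (2 * t)).
  rewrite -normrM prodE (le_trans (ler_norm_sum _ _ _))//.
  apply: (@le_trans _ _ (\sum_(j < d) e * (2 * t))); last first.
    by rewrite sumr_const card_ord -[X in X <= _]mulr_natl.
  rewrite big_mkcond /=; apply: ler_sum => j _; case: ifP => ji.
    rewrite normrM; apply: ler_pM => //; first by rewrite distrC ue.
    have := coord_le _ j ut; have := coord_le _ j u't.
    by have := ler_normD (u' j) (u j); lra.
  by rewrite !mulr_ge0// ltW.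
have absD : `|u i + u' i| = `|u i| + `|u' i|.
  move: sgn; have [h|h] := lerP 0 (u i).
    by move/esym => h'; rewrite !ger0_norm// addr_ge0.
  by move/esym/negbT; rewrite -ltNge => h'; rewrite !ltr0_norm//; lra.
have t2 : 0 < 2 * t by lra.
rewrite -(ler_pM2r t2).
apply: (@le_trans _ _ (`|u i - u' i| * (d%:R * `|u i + u' i|))).
  by apply: ler_wpM2l => //; rewrite absD mulrDr; lra.
rewrite mulrCA expr2 -!mulrA; apply: ler_wpM2l; first exact: ltW.
by rewrite (le_trans sum_le).
Qed.

Lemma eq_modn_close (q a b : nat) :
  a = b %[mod q] -> (a < b + q)%N -> (b < a + q)%N -> a = b.
Proof.
wlog ab : a b / (a <= b)%N => [H|] /eqP e aq bq.
  case/orP: (leq_total a b) => le; first exact: H (eqP e) aq bq.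
  by apply/esym/H => //; apply/esym/eqP.
move: e; rewrite eq_sym eqn_mod_dvd// => qd.
have [/eqP|pos] := posnP (b - a); first by rewrite subn_eq0 => ba; lia.
by have := dvdn_leq pos qd; lia.
Qed.

(** Each cell is determined by a coordinate i that is large at some point x of
    the sphere in the cell, the sign of that coordinate, the cell's other
    indices, and its index i modulo d^2 + 1 (for the dimension d): two cells
    agreeing in the first three data have i-th indices at distance less than
    d^2 + 1 by [sphere_coord_close]. *)
Lemma card_sphere_cells (R : realType) (d L : nat) (c : 'rV[R]_d.+1) (t : R)
    (A : {set {ffun 'I_d.+1 -> 'I_L}}) :
  0 < t ->
  (forall g, g \in A -> exists2 x : 'rV[R]_d.+1,
     cell R g x & \sum_i (x 0 i - c 0 i) ^+ 2 = t ^+ 2) ->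
  (#|A| <= 2 * d.+1 * (d.+1 ^ 2 + 1) * L ^ d)%N.
Proof.
move=> t0 meets.
have /choice[w wP] : forall g, exists w : 'rV[R]_d.+1 * 'I_d.+1, g \in A ->
    [/\ cell R g w.1, \sum_i (w.1 0 i - c 0 i) ^+ 2 = t ^+ 2 &
       t <= d.+1%:R * `|w.1 0 w.2 - c 0 w.2|].
  move=> g; case: (boolP (g \in A)) => [gA|_]; last by exists (0, ord0).
  have [x gx xt] := meets g gA.
  suff /existsP[i ti] : [exists i, t <= d.+1%:R * `|x 0 i - c 0 i|].
    by exists (x, i).
  (* if every coordinate were smaller than t / d, the squares would add up to
     less than t^2 *)
  rewrite -[X in is_true X]negbK negb_exists; apply/negP => /forallP small.
  have : t ^+ 2 < t ^+ 2; last by rewrite ltxx.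
  have d1 : 1 <= d.+1%:R :> R by rewrite ler1n.
  rewrite -{1}xt; apply: (@lt_le_trans _ _ (\sum_(i < d.+1) t ^+ 2 / d.+1%:R)).
    apply: ltr_sum => [|i _].
      by apply/hasP; exists ord0; rewrite ?mem_index_enum.
    have := small i; rewrite -ltNge => hi.
    rewrite ltr_pdivlMr ?ltr0n//.
    apply: (@le_lt_trans _ _ ((d.+1%:R * `|x 0 i - c 0 i|) ^+ 2)).
      rewrite exprMn real_normK ?num_real// mulrC ler_wpM2r ?sqr_ge0//.
      by rewrite expr2 ler_peMl// ler0n.
    by rewrite ltr_pXn2r// ?nnegrE ?mulr_ge0// ltW.
  by rewrite sumr_const card_ord -[X in X <= _]mulr_natr mulfVK ?pnatr_eq0.
pose Q := (d.+1 ^ 2 + 1)%N.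
have Q0 : (0 < Q)%N by rewrite /Q addn1.
pose code (g : {ffun 'I_d.+1 -> 'I_L}) :
    bool * 'I_d.+1 * 'I_Q * {ffun 'I_d -> 'I_L} :=
  let i := (w g).2 in
  (0 <= (w g).1 0 i - c 0 i, i, Ordinal (ltn_pmod (g i) Q0),
   [ffun j => g (lift i j)]).
have code_inj : {in A &, injective code}.
  move=> g h gA hA [].
  have := wP h hA; have := wP g gA.
  case: (w g) => x i /=; case: (w h) => x' i' /= [gx xt xi] [hx xt' xi'].
  move=> sgn ii; subst i' => gi /ffunP gh.
  have off j : j != i -> g j = h j.
    by rewrite eq_sym => /unlift_some[k -> _]; have := gh k; rewrite !ffunE.
  suff e : g i = h i by apply/ffunP => j; have [->//|/off] := eqVneq j i.
  have L0 : 0 < L%:R :> R by rewrite ltr0n (leq_ltn_trans _ (ltn_ord (g i))).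
  have close : L%:R * `|x 0 i - x' 0 i| <= d.+1%:R ^+ 2.
    rewrite mulrC -ler_pdivlMr//.
    have -> : x 0 i - x' 0 i = (x 0 i - c 0 i) - (x' 0 i - c 0 i) by ring.
    apply: (@sphere_coord_close _ _ t _ (fun j => x 0 j - c 0 j)
      (fun j => x' 0 j - c 0 j)) => //.
    move=> j ji; have -> : x 0 j - c 0 j - (x' 0 j - c 0 j) = x 0 j - x' 0 j by ring.
    rewrite -(ler_pM2l L0) divff ?gt_eqF// -[X in X * `|_|](gtr0_norm L0) -normrM.
    have := gx j; have := hx j; rewrite -(off _ ji) -natr1 => /andP[h1 h2] /andP[h3 h4].
    by rewrite ler_norml; apply/andP; split; lra.
  have near : `|L%:R * x 0 i - L%:R * x' 0 i| <= (d.+1 ^ 2)%:R.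
    by rewrite -mulrBr normrM (gtr0_norm L0) natrX.
  have := gx i; have := hx i; rewrite -!natr1 => /andP[h1 h2] /andP[h3 h4].
  move: near; rewrite ler_norml => /andP[h5 h6].
  by apply/val_inj/(@eq_modn_close Q) => //=; rewrite -(ltr_nat R) !natrD; lra.
rewrite -(card_in_imset code_inj) (leq_trans (max_card _))//.
by rewrite !card_prod card_bool !card_ord card_ffun !card_ord.
Qed.

(** * A sum of squares that dominates the pairs at distance t *)

(** Parseval's identity restricted to the frequencies below M; a translation by
    h multiplies each inner sum by a number of modulus 1. *)
Lemma discrete_bessel (R : realType) (d M L : nat) (h : 'rV[R]_d)
    (c : {ffun 'I_d -> 'I_L} -> R[i]) : (M <= L)%N ->
  \sum_(l : {ffun 'I_d -> 'I_M}) `|\sum_g c g * chi (freq l) (grid R g + h)| ^+ 2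
    <= (L ^ d)%:R * \sum_g `|c g| ^+ 2.
Proof.
move=> ML; rewrite -discrete_parseval.
pose widen (l : {ffun 'I_d -> 'I_M}) : {ffun 'I_d -> 'I_L} :=
  [ffun i => widen_ord ML (l i)].
have widen_inj : injective widen.
  move=> l l' /ffunP e; apply/ffunP => i; apply: val_inj.
  by have := congr1 val (e i); rewrite !ffunE.
have termE (l : {ffun 'I_d -> 'I_M}) :
    `|\sum_g c g * chi (freq l) (grid R g + h)| ^+ 2 =
    `|\sum_g c g * chi (freq (widen l)) (grid R g)| ^+ 2.
  have <- : freq l = freq (widen l) by apply/rowP => i; rewrite !mxE ffunE.
  under eq_bigr do rewrite chiD mulrA.
  by rewrite -mulr_suml normrM norm_chi mulr1.
under eq_bigr do rewrite termE.
pose F (l : {ffun 'I_d -> 'I_L}) := `|\sum_g c g * chi (freq l) (grid R g)| ^+ 2.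
have -> : \sum_l F (widen l) = \sum_(l in widen @: predT) F l.
  rewrite big_imset /=; last by move=> ? ? _ _; exact: widen_inj.
  by apply: eq_bigl => l; rewrite inE.
rewrite big_mkcond /=; apply: ler_sum => l _.
by case: ifP => // _; rewrite exprn_ge0.
Qed.

(** The side 1 / (8 d M) keeps every phase j.w in [0, 1/8], where the real part
    of the character is at least 1/2. *)
Lemma dirichlet_kernel_ge (R : realType) (d M : nat) (w : 'rV[R]_d) :
  (forall i, 0 <= w 0 i <= (8 * d * M)%:R^-1) ->
  ((M ^ d)%:R / 2) ^+ 2 <= `|\sum_(j : {ffun 'I_d -> 'I_M}) chi (freq j) w| ^+ 2.
Proof.
move=> small; set D := \sum_j _.
have phase (j : {ffun 'I_d -> 'I_M}) :
    1 / 2 <= cos (2 * pi * dotp (lattice_pt R (freq j)) w).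
  apply: cos_ge_half; rewrite ger0_norm; last first.
    by apply: sumr_ge0 => i _; rewrite !mxE mulr_ge0//; case/andP: (small i).
  case: (posnP d) => [d0|d0].
    rewrite /dotp big1 => [|i]; first by lra.
    by have := ltn_ord i; rewrite [X in (_ < X)%N]d0.
  apply: (@le_trans _ _ (\sum_(i < d) (8 * d%:R)^-1)).
    apply: ler_sum => i _; rewrite !mxE.
    have M0 : 0 < M%:R :> R by rewrite ltr0n (leq_ltn_trans _ (ltn_ord (j i))).
    have /andP[w0 w1] := small i.
    apply: (le_trans (ler_pM _ w0 (_ : _ <= M%:R) w1)) => //.
      by rewrite ler_nat ltnW.
    by rewrite natrM natrM invfM mulrCA divff ?mulr1// gt_eqF.
  rewrite sumr_const card_ord -[X in X <= _]mulr_natl invfM mulrCA divff ?mulr1.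
    by lra.
  by rewrite pnatr_eq0 -lt0n.
have ReD : ((M ^ d)%:R / 2)%:C%C <= 'Re D.
  rewrite raddf_sum /=.
  have -> : (M ^ d)%:R / 2 = \sum_(j : {ffun 'I_d -> 'I_M}) (1 / 2 : R).
    by rewrite sumr_const card_ffun !card_ord -[RHS]mulr_natl mul1r.
  rewrite (raddf_sum (real_complex R)) /=; apply: ler_sum => j _.
  by rewrite -complexRe lecR phase.
have -> : (M ^ d)%:R / 2 = ((M ^ d)%:R / 2)%:C%C :> R[i].
  by rewrite rmorphM fmorphV !rmorph_nat.
rewrite ler_pXn2r ?nnegrE ?normr_ge0 ?ler0c ?divr_ge0//.
apply: (le_trans ReD); apply: le_trans (normc_ge_Re D).
by rewrite -complexRe lecR ler_norm.
Qed.

(** As t < 1/2, the sphere of radius t around this point lies in the open unit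
    cube and is covered by the cells with indices in [0, L). *)
Definition cube_center (R : realType) (d : nat) : 'rV[R]_d := const_mx (1 / 2).
Arguments cube_center : clear implicits.

Definition sphere_cells (R : realType) (d L : nat) (t : R) :
    {set {ffun 'I_d -> 'I_L}} :=
  [set g | `[< exists2 x : 'rV[R]_d,
     cell R g x & \sum_i (x 0 i - cube_center R d 0 i) ^+ 2 = t ^+ 2 >]].

(** The point z, reduced modulo the lattice to norm t and moved to the sphere
    around the centre of the cube, lies in some cell g. *)
Lemma sphere_cells_cover (R : realType) (d L : nat) (t : R) (z : 'rV[R]_d) :
  (0 < L)%N -> 0 < t < 1 / 2 -> lattice_dist z = t ->
  exists2 g, g \in sphere_cells d L t & exists m : 'rV[int]_d, forall i,
    0 <= (z - (grid R g - cube_center R d) - lattice_pt R m) 0 i <= L%:R^-1.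
Proof.
move=> L0 /andP[t0 t2] zt; have [m zm _] := lattice_dist_min z.
pose u := z - lattice_pt R m.
have ut : \sum_i u 0 i ^+ 2 = t ^+ 2.
  rewrite -zt zm /enorm sqr_sqrtr//.
  by apply: sumr_ge0 => i _; exact: sqr_ge0.
have u_lt i : `|u 0 i| < 1 / 2.
  apply: le_lt_trans t2; rewrite -(@ler_pXn2r _ 2)// ?nnegrE ?(ltW t0)// -ut.
  rewrite (bigD1 i)//= real_normK ?num_real// lerDl.
  by apply: sumr_ge0 => l _; exact: sqr_ge0.
have LR : 0 < L%:R :> R by rewrite ltr0n.
pose x := u + cube_center R d.
have x01 i : 0 <= L%:R * x 0 i < L%:R.
  have := u_lt i; rewrite ltr_norml => /andP[u1 u2].
  rewrite [x 0 i]mxE [cube_center R d 0 i]mxE; apply/andP; split.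
    by rewrite mulr_ge0 ?ltW//; lra.
  by rewrite gtr_pMr//; lra.
have trunc_lt i : (Num.truncn (L%:R * x 0 i)%R < L)%N.
  have /andP[h1 h2] := x01 i.
  by rewrite -(ltr_nat R) (le_lt_trans _ h2)// truncn_le.
pose g : {ffun 'I_d -> 'I_L} := [ffun i => Ordinal (trunc_lt i)].
have gx : cell R g x.
  move=> i; rewrite ffunE /=; have /andP[h1 h2] := x01 i.
  exact: truncn_itv.
exists g.
  rewrite inE; apply/asboolP; exists x => //; rewrite -ut; apply: eq_bigr => i _.
  by rewrite [x 0 i]mxE addrK.
exists m => i.
have -> : (z - (grid R g - cube_center R d) - lattice_pt R m) 0 i =
    x 0 i - (g i)%:R / L%:R by rewrite !mxE; ring.
have := gx i; rewrite -natr1 => /andP[h1 h2].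
rewrite subr_ge0 ler_pdivrMr// mulrC h1 lerBlDr -(ler_pM2l LR) mulrDr divff ?gt_eqF//.
by rewrite mulrCA divff ?gt_eqF// mulr1 addrC ltW.
Qed.

(** For a pair at distance t, the cell of [sphere_cells_cover] alone gives a
    large enough term; characters ignore the translation by the lattice. *)
Lemma dist_pairs_le_sum (R : realType) (d M L N : nat) (v : nat -> 'rV[R]_d) (t : R) :
  (0 < L)%N -> (0 < M)%N -> (8 * d * M <= L)%N -> 0 < t < 1 / 2 ->
  #|dist_pairs v t N|%:R * ((M ^ d)%:R / 2) ^+ 2 <=
  \sum_(n < N) \sum_(m < N) \sum_(g in sphere_cells d L t)
    `|\sum_(j : {ffun 'I_d -> 'I_M})
        chi (freq j) (v n.+1 - v m.+1 - (grid R g - cube_center R d))| ^+ 2 :> R[i].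
Proof.
move=> L0 M0 ML t01.
rewrite pair_bigA /= mulr_natl -sumr_const.
rewrite [leLHS]big_mkcond /=; apply: ler_sum => -[n m] _ /=.
case: ifP => [|_]; last first.
  by apply: sumr_ge0 => g _; rewrite exprn_ge0.
rewrite inE /= => /eqP /(sphere_cells_cover L0 t01)[g gA [p gp]].
rewrite (bigD1 g)//=.
set z := v _ - v _ - _ in gp *.
have -> : \sum_(j : {ffun 'I_d -> 'I_M}) chi (freq j) z =
    \sum_(j : {ffun 'I_d -> 'I_M}) chi (freq j) (z - lattice_pt R p).
  by apply: eq_bigr => j _; rewrite chiD chiN chi_lattice conjC1 mulr1.
rewrite ler_wpDr//; first by apply: sumr_ge0 => g' _; rewrite exprn_ge0.
apply: dirichlet_kernel_ge => i; have /andP[-> h] := gp i.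
have [d0|d0] := posnP d; first by have := ltn_ord i; rewrite [X in (_ < X)%N]d0.
by rewrite (le_trans h)// lef_pV2 ?posrE ?ltr0n ?ler_nat// !muln_gt0 d0 M0.
Qed.

(** The bound a <= a^2 / s + s reduces the sum of moduli to the sum of squares;
    it loses only a constant when s is close to the root mean square. *)
Lemma cell_sums_le (R : realType) (d M L : nat) (A : {set {ffun 'I_d -> 'I_L}})
    (h : 'rV[R]_d) (k : 'rV[int]_d) (s : R) :
  (M <= L)%N -> 0 < s ->
  \sum_(l : {ffun 'I_d -> 'I_M})
      `|\sum_(g in A) chi (freq l - k) (grid R g + h)| <=
    ((L ^ d)%:R * #|A|%:R / s + (M ^ d)%:R * s)%:C%C.
Proof.
move=> ML s0.
pose c (g : {ffun 'I_d -> 'I_L}) : R[i] :=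
  if g \in A then (chi k (grid R g + h))^* else 0.
have aE (l : {ffun 'I_d -> 'I_M}) :
    \sum_(g in A) chi (freq l - k) (grid R g + h) =
    \sum_g c g * chi (freq l) (grid R g + h).
  rewrite big_mkcond; apply: eq_bigr => g _; rewrite /c.
  by case: ifP => _; rewrite ?mul0r// chiDl chiNl mulrC.
under eq_bigr do rewrite aE.
have s0C : 0 < s%:C%C by rewrite ltcR.
have sq := discrete_bessel h c ML.
have cA : \sum_g `|c g| ^+ 2 = #|A|%:R.
  rewrite -sumr_const [RHS]big_mkcond; apply: eq_bigr => g _ /=; rewrite /c.
  by case: ifP => _; rewrite ?normr0 ?expr0n// norm_conjC norm_chi expr1n.
rewrite cA in sq.
have -> : ((L ^ d)%:R * #|A|%:R / s + (M ^ d)%:R * s)%:C%C =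
   (L ^ d)%:R * #|A|%:R / s%:C%C + \sum_(l : {ffun 'I_d -> 'I_M}) s%:C%C.
  rewrite sumr_const card_ffun !card_ord -[X in _ = _ + X]mulr_natl.
  by rewrite rmorphD !rmorphM fmorphV !rmorph_nat.
apply: le_trans (_ : _ <= \sum_(l : {ffun 'I_d -> 'I_M})
    (`|\sum_g c g * chi (freq l) (grid R g + h)| ^+ 2 / s%:C%C + s%:C%C)) _.
  apply: ler_sum => l _; set a := `|_|.
  have a0 : 0 <= a by exact: normr_ge0.
  rewrite -(ler_pM2r s0C) mulrDl divfK ?gt_eqF// -expr2.
  rewrite -subr_ge0.
  have -> : a ^+ 2 + s%:C%C ^+ 2 - a * s%:C%C = (a - s%:C%C) ^+ 2 + a * s%:C%C.
    by ring.
  apply: addr_ge0; last by rewrite mulr_ge0 ?(ltW s0C).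
  by rewrite real_exprn_even_ge0// realB ?ger0_real ?(ltW s0C).
rewrite big_split lerD2r/= -mulr_suml ler_wpM2r// invr_ge0 ltW//.
Qed.

(** The diagonal j = l, where the exponential sum is N, gives the first term;
    off the diagonal the exponential sums are bounded by P and the sums over
    cells by [cell_sums_le], row by row. *)
Lemma dist_pairs_sieve (R : realType) (d M L N : nat) (v : nat -> 'rV[R]_d)
    (t P s : R) :
  (0 < d)%N -> (0 < M)%N -> (8 * d * M <= L)%N -> 0 < t < 1 / 2 -> 0 <= P -> 0 < s ->
  (forall k : 'rV[int]_d, k != 0 -> (forall i, (absz (k 0%R i) < M)%N) ->
     `|\sum_(n < N) chi k (v n.+1)| ^+ 2 <= P%:C%C) ->
  let a := #|sphere_cells d L t| in
  #|dist_pairs v t N|%:R * ((M ^ d)%:R / 2) ^+ 2 <=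
  (M ^ d)%:R * (N%:R ^+ 2 * a%:R + P * ((L ^ d)%:R * a%:R / s + (M ^ d)%:R * s)).
Proof.
move=> d0 M0 ML t01 P0 s0 expsum; set a := #|_|; cbv zeta.
have ML' : (M <= L)%N by rewrite (leq_trans _ ML)// leq_pmull// muln_gt0 d0.
have L0 : (0 < L)%N by exact: leq_trans ML'.
pose S (j l : {ffun 'I_d -> 'I_M}) :=
  \sum_(n < N) chi (freq j - freq l) (v n.+1).
pose T (j l : {ffun 'I_d -> 'I_M}) := \sum_(g in sphere_cells d L t)
  chi (freq j - freq l) (- (grid R g - cube_center R d)).
have := dist_pairs_le_sum N v L0 M0 ML t01.
rewrite (sum_square_trig_poly (fun n : 'I_N => v n.+1)
  (fun g => grid R g - cube_center R d)) -/S => le_sum.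
rewrite -lecR.
have -> : (#|dist_pairs v t N|%:R * ((M ^ d)%:R / 2) ^+ 2)%:C%C =
    #|dist_pairs v t N|%:R * ((M ^ d)%:R / 2) ^+ 2 :> R[i].
  by rewrite rmorphM rmorphXn rmorphM fmorphV !rmorph_nat.
have X0 : 0 <= #|dist_pairs v t N|%:R * ((M ^ d)%:R / 2) ^+ 2 :> R[i].
  by rewrite mulr_ge0// exprn_ge0// divr_ge0.
have {}le_sum := le_trans le_sum (real_ler_norm (ger0_real (le_trans X0 le_sum))).
apply: (le_trans le_sum).
have Sle j l : j != l -> `|S j l| ^+ 2 <= P%:C%C.
  move=> jl; apply: expsum => [|i].
    rewrite subr_eq0; apply: contra jl => /eqP/rowP e.
    apply/eqP/ffunP => i; apply/val_inj; have := e i.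
    by rewrite !mxE => -[].
  have dist_lt (p q : nat) : (p < M)%N -> (q < M)%N -> (absz (p%:Z - q%:Z)%R < M)%N.
    by lia.
  by rewrite !mxE dist_lt.
have Sdiag j : `|S j j| ^+ 2 = N%:R ^+ 2.
  rewrite /S subrr (eq_bigr (fun=> 1)) => [|n _]; last by rewrite chi0.
  by rewrite sumr_const card_ord normr_nat.
have Tle j l : `|T j l| <= a%:R.
  rewrite (le_trans (ler_norm_sum _ _ _))// -sumr_const.
  by apply: ler_sum => g _; rewrite norm_chi.
have Trow j : \sum_l `|T j l| <= ((L ^ d)%:R * a%:R / s + (M ^ d)%:R * s)%:C%C.
  rewrite (le_trans _ (cell_sums_le (sphere_cells d L t)
    (- cube_center R d) (freq j) ML' s0))//.
  apply: ler_sum => l _; rewrite le_eqVlt; apply/orP; left; apply/eqP.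
  congr `|_|; apply: eq_bigr => g _.
  by rewrite chiN -chiNl opprB.
rewrite (le_trans (ler_norm_sum _ _ _))//.
have row_le j : `|\sum_l `|S j l| ^+ 2 * T j l| <=
    (N%:R ^+ 2 * a%:R + P * ((L ^ d)%:R * a%:R / s + (M ^ d)%:R * s))%:C%C.
  rewrite (le_trans (ler_norm_sum _ _ _))// [leRHS]rmorphD /=.
  rewrite [X in _ <= X + _]rmorphM rmorphXn !rmorph_nat.
  rewrite (bigD1 j)//=; apply: lerD.
    by rewrite normrM normrX normr_id Sdiag ler_wpM2l// exprn_ge0.
  have P0' : 0 <= P%:C%C by rewrite ler0c.
  rewrite [leRHS]rmorphM; apply: le_trans (ler_wpM2l P0' (Trow j)).
  rewrite mulr_sumr [leRHS](bigD1 j)//= ler_wpDl ?mulr_ge0//.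
  apply: ler_sum => l lj; rewrite normrM normrX normr_id ler_wpM2r//.
  by rewrite Sle// eq_sym.
apply: le_trans (ler_sum _ (fun j _ => row_le j)) _.
by rewrite sumr_const card_ffun !card_ord -[leLHS]mulr_natl [leRHS]rmorphM rmorph_nat.
Qed.

(** [dist_pairs_sieve] with L = 8 d M and s = M^((d-1)/2) for the dimension d,
    the square root of the order of magnitude of the number of cells. *)
Lemma dist_pairs_bound (R : realType) (d : nat) (t : R) : 0 < t < 1 / 2 ->
  exists2 K : R, 0 < K & forall (v : nat -> 'rV[R]_d.+1) (M N : nat) (P : R),
    (0 < M)%N -> 0 <= P ->
    (forall k : 'rV[int]_d.+1, k != 0 -> (forall i, (absz (k 0%R i) < M)%N) ->
      `|\sum_(n < N) chi k (v n.+1)| ^+ 2 <= P%:C%C) ->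
    #|dist_pairs v t N|%:R <=
      K * (N%:R ^+ 2 / M%:R + P * Num.sqrt (M%:R ^+ d)).
Proof.
move=> t01.
pose K1 := (2 * d.+1 * (d.+1 ^ 2 + 1) * (8 * d.+1) ^ d)%N.
pose K0 := ((8 * d.+1) ^ d.+1)%N.
exists (4 * (K0 * K1 + K1 + 1)%:R) => [|v M N P M0 P0 expsum].
  by rewrite mulr_gt0// ltr0n addn1.
pose L := (8 * d.+1 * M)%N; set s := Num.sqrt _.
have MR : 0 < M%:R :> R by rewrite ltr0n.
have s0 : 0 < s by rewrite sqrtr_gt0 exprn_gt0.
have s2 : s ^+ 2 = M%:R ^+ d by rewrite sqr_sqrtr// exprn_ge0// ltW.
have := dist_pairs_sieve (ltn0Sn d) M0 (leqnn L) t01 P0 s0 expsum.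
cbv zeta; set a := #|sphere_cells _ _ _|.
have aK : a%:R <= K1%:R * s ^+ 2.
  have [t0 _] := andP t01.
  rewrite s2 -natrX -natrM ler_nat.
  have meets g : g \in sphere_cells d.+1 L t -> exists2 x : 'rV[R]_d.+1,
      cell R g x & \sum_i (x 0 i - cube_center R d.+1 0 i) ^+ 2 = t ^+ 2.
    by rewrite inE => /asboolP.
  by rewrite (leq_trans (card_sphere_cells t0 meets))// /L expnMn mulnA.
have -> : (L ^ d.+1)%:R = K0%:R * (M ^ d.+1)%:R :> R by rewrite -natrM -expnMn.
set J := (M ^ d.+1)%:R : R.
have JE : J = M%:R * s ^+ 2 by rewrite s2 /J natrX exprS.
have J0 : 0 < J by rewrite /J ltr0n expn_gt0 M0.
pose W := N%:R ^+ 2 / M%:R : R.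
have W0 : 0 <= W by rewrite divr_ge0// exprn_ge0.
have as_le : a%:R / s <= K1%:R * s by rewrite ler_pdivrMr// -mulrA -expr2.
have diag_le : N%:R ^+ 2 * a%:R <= J * (K1%:R * W).
  have -> : J * (K1%:R * W) = N%:R ^+ 2 * (K1%:R * s ^+ 2).
    by rewrite JE /W; field; rewrite gt_eqF.
  by rewrite ler_wpM2l// exprn_ge0.
have offdiag_le : P * (K0%:R * J * a%:R / s + J * s) <=
    J * ((K0 * K1)%:R * (P * s) + P * s).
  have -> : J * ((K0 * K1)%:R * (P * s) + P * s) =
      P * (K0%:R * J * (K1%:R * s) + J * s) by rewrite natrM; ring.
  by rewrite ler_wpM2l// lerD2r -mulrA ler_wpM2l// mulr_ge0// ltW.
have Ps0 : 0 <= P * s by rewrite mulr_ge0// ltW.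
move=> le_X; rewrite -(ler_pM2r (exprn_gt0 2 (divr_gt0 J0 (ltr0Sn R 1)))).
apply: (le_trans le_X).
have -> : 4 * (K0 * K1 + K1 + 1)%:R * (W + P * s) * (J / 2) ^+ 2 =
  J * (J * ((K0 * K1 + K1 + 1)%:R * (W + P * s))) by field.
apply: ler_wpM2l; first exact: ltW.
apply: (le_trans (lerD diag_le offdiag_le)); rewrite -mulrDr.
apply: ler_wpM2l; first exact: ltW.
rewrite natrD [(_ + K1)%:R]natrD (natrM _ K0 K1).
set k0 := K0%:R; set k1 := K1%:R.
have [k00 k10] : 0 <= k0 /\ 0 <= k1 by rewrite !ler0n.
rewrite -subr_ge0.
have -> : (k0 * k1 + k1 + 1) * (W + P * s) - (k1 * W + (k0 * k1 * (P * s) + P * s))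
  = k0 * k1 * W + W + k1 * (P * s) by ring.
apply: addr_ge0; last exact: mulr_ge0.
by apply: addr_ge0 => //; apply: mulr_ge0 => //; exact: mulr_ge0.
Qed.

(** * Uniform distribution and the choice of M *)

Lemma enorm_lattice_le (R : realType) (d M : nat) (k : 'rV[int]_d) :
  (forall i, (absz (k 0%R i) <= M)%N) ->
  enorm (lattice_pt R k) <= (d * M)%:R.
Proof.
move=> kM; rewrite -[leRHS]ger0_norm// -sqrtr_sqr ler_wsqrtr//.
apply: (@le_trans _ _ (\sum_(i < d) M%:R ^+ 2)).
  apply: ler_sum => i _; rewrite !mxE -real_normK ?num_real// -intr_norm.
  by rewrite ler_pXn2r// ?nnegrE// -abszE ler_nat.
rewrite sumr_const card_ord -natrX -mulrnA -natrX ler_nat expnMn mulnC.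
by rewrite leq_mul2r; case: (d) => [|m]; rewrite ?orbT// leq_pmull ?orbT.
Qed.

(** Squared and multiplied by N^2, the hypothesis gives |S|^2 <= C N |k|^(2e),
    and |k| <= d M. *)
Lemma uniformly_distributed_sum_le (R : realType) (d : nat)
    (v : nat -> 'rV[R]_d) (e : R) :
  uniformly_distributed (1 / 2) v -> 0 < e ->
  exists2 B : R, 0 <= B & forall (M N : nat) (k : 'rV[int]_d),
    (1 <= N)%N -> k != 0 -> (forall i, (absz (k 0%R i) <= M)%N) ->
    `|\sum_(n < N) chi k (v n.+1)| ^+ 2 <=
      (B * (M%:R `^ e) ^+ 2 * N%:R)%:C%C.
Proof.
move=> unif e0; have [C CP] := unif e e0.
exists ((`|C| * d%:R `^ e) ^+ 2) => [|M N k N1 k0 kM]; first exact: sqr_ge0.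
have x0 : 0 < N%:R :> R by rewrite ltr0n.
have := CP k N k0 N1.
rewrite big_add1 big_mkord normrM normfV normr_nat.
set S := `|_|; set q := enorm _ => SN.
have S_le : S <= (N%:R * (C * q `^ e * N%:R `^ (- (1 / 2))))%:C%C.
  by rewrite rmorphM rmorph_nat -ler_pdivrMl ?ltr0n.
have root : (N%:R `^ (- (1 / 2))) ^+ 2 = N%:R^-1 :> R.
  rewrite -powR_mulrn ?powR_ge0// -powRrM -[RHS]powR_inv1 ?ler0n//.
  by congr (_ `^ _); lra.
have b0 : 0 <= N%:R * (`|C| * (d%:R * M%:R) `^ e * N%:R `^ (- (1 / 2))) :> R.
  by rewrite !mulr_ge0 ?powR_ge0.
have S_le' : S <= (N%:R * (`|C| * (d%:R * M%:R) `^ e * N%:R `^ (- (1 / 2))))%:C%C.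
  apply: le_trans S_le _; rewrite lecR; apply: ler_wpM2l => //.
  apply: ler_wpM2r; first exact: powR_ge0.
  apply: le_trans (ler_wpM2r (powR_ge0 _ _) (ler_norm C)) _.
  apply: ler_wpM2l => //.
  apply: ge0_ler_powR; rewrite ?nnegrE ?mulr_ge0 ?sqrtr_ge0 ?(ltW e0)//.
  by rewrite -natrM enorm_lattice_le.
have -> : ((`|C| * d%:R `^ e) ^+ 2 * (M%:R `^ e) ^+ 2 * N%:R) =
    (N%:R * (`|C| * (d%:R * M%:R) `^ e * N%:R `^ (- (1 / 2)))) ^+ 2.
  rewrite !exprMn root powRM// exprMn.
  by field; rewrite gt_eqF.
rewrite [leRHS]rmorphXn ler_pXn2r ?nnegrE ?normr_ge0 ?ler0c//.
Qed.

Theorem corollary1p3 (R : realType) (d : nat) (v : nat -> 'rV[R]_d) (t : R) :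
  (2 <= d)%N ->
  (forall n : nat, (1 <= n)%N -> unit_cube (v n)) ->
  uniformly_distributed (1 / 2) v ->
  0 < t < 1 / 2 ->
  forall eps : R, 0 < eps ->
  exists2 C : R, 0 < C &
    forall N : nat, (1 <= N)%N ->
      #|dist_pairs v t N|%:R <= C * N%:R `^ (2 - 2 / (d%:R + 1) + eps).
Proof.
case: d v => [|d] v // d1 _ unif t01 eps eps0.
have e0 : 0 < eps / 2 by rewrite divr_gt0.
have [B B0 sums] := uniformly_distributed_sum_le unif e0.
have [K K0 pairs] := dist_pairs_bound d t01.
exists (K * (2 + B)) => [|N N1]; first by rewrite mulr_gt0// ltr_wpDr.
set x := N%:R : R; set D := d.+1%:R + 1 : R.
have x1 : 1 <= x by rewrite ler1n.
have x0 : 0 < x by exact: lt_le_trans x1.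
have D0 : 0 < D by rewrite addr_gt0.
(* z is N^(1/(d+1)) for the dimension d, and M is about z^2 *)
pose z := x `^ D^-1.
have z0 : 0 < z by rewrite powR_gt0.
have z1 : 1 <= z by rewrite -(powRr0 x) ler_powR// invr_ge0 ltW.
have zD : z ^+ d.+2 = x.
  rewrite -powR_mulrn ?(ltW z0)// -powRrM -[d.+2%:R]natr1 mulVf ?gt_eqF//.
  by rewrite powRr1 ?ltW.
have xE : x `^ (2 - 2 / D + eps) = x ^+ 2 / z ^+ 2 * x `^ eps.
  rewrite powRD ?(gt_eqF x0) ?implybT// powRB ?(gt_eqF x0) ?implybT//.
  rewrite powR_mulrn ?(ltW x0)// [2 / D]mulrC powRrM powR_mulrn ?(ltW z0)//.
pose M := Num.truncn (z ^+ 2).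
have z21 : 1 <= z ^+ 2 by rewrite exprn_ege1.
have /andP[Mle Mgt] := truncn_itv (le_trans ler01 z21); rewrite -/M in Mle Mgt.
have M0 : (0 < M)%N by rewrite truncn_gt0.
have MR : 1 <= M%:R :> R by rewrite ler1n.
pose P := B * (M%:R `^ (eps / 2)) ^+ 2 * x.
have P0 : 0 <= P by rewrite !mulr_ge0 ?exprn_ge0 ?powR_ge0 ?(ltW x0).
have := pairs v M N P M0 P0 (fun k k0 kM => sums M N k N1 k0 (fun i => ltnW (kM i))).
move=> /le_trans; apply; rewrite -/x xE -mulrA; apply: ler_wpM2l; first exact: ltW.
have xe1 : 1 <= x `^ eps by rewrite -(powRr0 x) ler_powR// ltW.
have Mx : (M%:R `^ (eps / 2)) ^+ 2 <= x `^ eps.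
  have -> : x `^ eps = (x `^ (eps / 2)) ^+ 2.
    by rewrite -powR_mulrn ?powR_ge0// -powRrM divfK.
  rewrite ler_pXn2r ?nnegrE ?powR_ge0//.
  apply: ge0_ler_powR; rewrite ?nnegrE ?(ltW e0) ?(ltW x0)//.
  by rewrite (le_trans Mle)// -zD ler_weXn2l.
have z20 : 0 < z ^+ 2 by rewrite exprn_gt0.
have sqrt_le : x * Num.sqrt (M%:R ^+ d) <= x ^+ 2 / z ^+ 2.
  rewrite expr2 -mulrA ler_wpM2l ?(ltW x0)// ler_pdivlMr// -zD -[d.+2]addn2 exprD.
  rewrite ler_wpM2r ?(ltW z20)// -[leRHS]ger0_norm ?exprn_ge0 ?(ltW z0)//.
  rewrite -sqrtr_sqr ler_wsqrtr// -exprM mulnC exprM.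
  by rewrite lerXn2r ?nnegrE ?(ltW z20).
have main_le : x ^+ 2 / M%:R <= 2 * (x ^+ 2 / z ^+ 2).
  rewrite mulrCA; apply: ler_wpM2l; first by rewrite exprn_ge0// ltW.
  rewrite ler_pdivlMr// ler_pdivrMl ?(lt_le_trans ltr01 MR)//.
  by move: Mgt; rewrite -natr1; lra.
pose W := x ^+ 2 / z ^+ 2; rewrite -/W in sqrt_le main_le *.
have W0 : 0 <= W by rewrite divr_ge0 ?exprn_ge0 ?ltW.
rewrite mulrDl; apply: lerD.
  by apply: (le_trans main_le); rewrite ler_wpM2l// ler_peMr.
have -> : P * Num.sqrt (M%:R ^+ d) =
    B * ((M%:R `^ (eps / 2)) ^+ 2 * (x * Num.sqrt (M%:R ^+ d))) by rewrite /P !mulrA.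
apply: ler_wpM2l => //; rewrite [leRHS]mulrC.
apply: ler_pM => //.
by rewrite mulr_ge0 ?sqrtr_ge0 ?(ltW x0).
Qed.
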